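(* Let $G=(V,A)$ be a flow graph with start vertex $s$, let $T=(V,A_T)$ be a spanning tree of $G$ rooted at $s$ (so $A_T\subseteq A$), let $D$ be the dominator tree of $G$, and fix a low-high order of $G$ (a preorder of $D$), written $<$. For $v\neq s$ let $t(v)$ be the parent of $v$ in $T$ and $d(v)$ the parent of $v$ in $D$. Construct a set $A'\subseteq A$ as follows: start with $A'=\emptyset$, and for each vertex $v\neq s$: (1) if $t(v)=d(v)$, add nothing; (2) if $t(v)\neq d(v)$ and $(d(v),v)\in A$, add $(d(v),v)$ to $A'$; (3) if $(d(v),v)\notin A$: (3a) if $t(v)>v$, add to $A'$ some arc $(x,v)\in A$ with $x<v$; (3b) if $t(v)<v$, add to $A'$ some arc $(x,v)\in A$ with $x>v$ and $x$ not a descendant of $v$ in $D$. Then in each instance of cases (2), (3a), (3b) an arc with the required property exists (so the construction is well defined for any choices made), and the resulting set $A'$ is a minimum-size valid set, i.e., $A'$ is valid and every valid set $A''\subseteq A$ satisfies $|A''|\ge |A'|$.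
   Context: A flow graph is a directed graph $G=(V,A)$ with a distinguished start vertex $s$ such that every vertex is reachable from $s$. A vertex $u$ dominates a vertex $w$ if every path from $s$ to $w$ contains $u$. The immediate dominator $d(v)$ of $v\neq s$ is the dominator of $v$ other than $v$ that is dominated by all other dominators of $v$ other than $v$; the dominator tree $D$ is the tree rooted at $s$ in which the parent of each $v\neq s$ is $d(v)$ (so the dominators of $v$ are exactly its ancestors in $D$). A low-high order of $G$ is a preorder (depth-first order, parent before children) of $D$ such that for every vertex $v\neq s$, either $(d(v),v)\in A$, or there are two arcs $(u,v),(w,v)\in A$ with $u<v<w$ and $w$ not a descendant of $v$ in $D$. Given the spanning tree $T=(V,A_T)$ rooted at $s$ with $A_T\subseteq A$, a set of arcs $A''\subseteq A$ is called valid if the subgraph $G''=(V,A_T\cup A'')$ with start vertex $s$ has exactly the same dominance relation as $G$ (for all $u,w\in V$, $u$ dominates $w$ in $G''$ iff $u$ dominates $w$ in $G$). *)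

(* Defs.v *)
From mathcomp Require Import all_boot.
Set Implicit Arguments.
Unset Strict Implicit.
Unset Printing Implicit Defensive.

Definition arc (V : finType) (A : {set V * V}) : rel V :=
  [rel u v | (u, v) \in A].

Definition flow_graph (V : finType) (A : {set V * V}) (s : V) : Prop :=
  forall v : V, connect (arc A) s v.

(* Paths are walks from [s]; the walk [s :: q] includes its start vertex, so
   [s] dominates every vertex and every vertex dominates itself. *)
Definition dominates (V : finType) (A : {set V * V}) (s u w : V) : Prop :=
  forall q : seq V, path (arc A) s q -> last s q = w -> u \in s :: q.

Definition immediate_dominator (V : finType) (A : {set V * V})
    (s v u : V) : Prop :=
  [/\ dominates A s u v, u <> v
    & forall x : V, dominates A s x v -> x <> v -> dominates A s x u].

(* Rooted trees on [V] are given by their sets of (parent, child) arcs. *)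
Definition spanning_tree (V : finType) (E : {set V * V}) (s : V) : Prop :=
  [/\ forall u : V, (u, s) \notin E,
      forall v : V, v != s -> exists! u : V, (u, v) \in E
    & forall v : V, connect (arc E) s v].

(* The default value [v] is irrelevant: it is only returned at the root. *)
Definition parent (V : finType) (E : {set V * V}) (v : V) : V :=
  odflt v [pick u | (u, v) \in E].

(* Reflexive: [v] is a descendant of itself. *)
Definition descendant (V : finType) (E : {set V * V}) (v w : V) : bool :=
  connect (arc E) v w.

Definition dominator_tree (V : finType) (A : {set V * V}) (s : V)
    (D : {set V * V}) : Prop :=
  forall u v : V, (u, v) \in D <-> v != s /\ immediate_dominator A s v u.

(* [preorder E v l]: some depth-first traversal of the subtree of [E] rooted
   at [v], visiting the children of each vertex in an arbitrary order, lists
   the vertices in the order [l]; [preorders E cs l] concatenates such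
   traversals for the roots [cs]. *)
Inductive preorder (V : finType) (E : {set V * V}) : V -> seq V -> Prop :=
| Preorder (v : V) (cs l : seq V) :
    uniq cs -> (forall c : V, (c \in cs) = ((v, c) \in E)) ->
    preorders E cs l -> preorder E v (v :: l)
with preorders (V : finType) (E : {set V * V}) : seq V -> seq V -> Prop :=
| PreordersNil : preorders E [::] [::]
| PreordersCons (c : V) (cs l ls : seq V) :
    preorder E c l -> preorders E cs ls -> preorders E (c :: cs) (l ++ ls).

Definition before (V : finType) (p : seq V) (u v : V) : bool :=
  index u p < index v p.

Definition low_arc (V : finType) (A : {set V * V}) (p : seq V)
    (x v : V) : Prop :=
  (x, v) \in A /\ before p x v.

Definition high_arc (V : finType) (A D : {set V * V}) (p : seq V)
    (x v : V) : Prop :=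
  [/\ (x, v) \in A, before p v x & ~~ descendant D v x].

Definition low_high_order (V : finType) (A : {set V * V}) (s : V)
    (D : {set V * V}) (p : seq V) : Prop :=
  preorder D s p /\
  forall v : V, v != s ->
    (parent D v, v) \in A \/
    (exists u w : V, low_arc A p u v /\ high_arc A D p w v).

Definition valid (V : finType) (A : {set V * V}) (s : V)
    (AT A'' : {set V * V}) : Prop :=
  A'' \subset A /\
  forall u w : V, dominates (AT :|: A'') s u w <-> dominates A s u w.

Definition minimum_valid (V : finType) (A : {set V * V}) (s : V)
    (AT A' : {set V * V}) : Prop :=
  valid A s AT A' /\
  forall A'' : {set V * V}, valid A s AT A'' -> #|A'| <= #|A''|.

(* [step A AT D p v S]: the construction may add exactly the arcs of [S] when
   it processes [v]. *)
Inductive step (V : finType) (A AT D : {set V * V}) (p : seq V) (v : V) :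
    {set V * V} -> Prop :=
| Step1 : parent AT v = parent D v -> step A AT D p v set0
| Step2 : parent AT v <> parent D v -> (parent D v, v) \in A ->
    step A AT D p v [set (parent D v, v)]
| Step3a (x : V) : (parent D v, v) \notin A -> before p v (parent AT v) ->
    low_arc A p x v -> step A AT D p v [set (x, v)]
| Step3b (x : V) : (parent D v, v) \notin A -> before p (parent AT v) v ->
    high_arc A D p x v -> step A AT D p v [set (x, v)].

Definition construction (V : finType) (A : {set V * V}) (s : V)
    (AT D : {set V * V}) (p : seq V) (A' : {set V * V}) : Prop :=
  exists B : V -> {set V * V},
    (forall v : V, v != s -> step A AT D p v (B v)) /\
    A' = \bigcup_(v | v != s) B v.

(* Main.v *)
(** Every valid set must contain a non-tree arc into each vertex [v] with
    [t v != d v]: otherwise [t v] is the only predecessor of [v], hence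
    dominates it, which forces [t v = d v].  The construction adds one arc per
    such vertex, so only validity remains.  The [D]-subtree of [v] occupies
    an interval of the preorder, and [t v] never descends from [v] in [D], so
    the given order is low-high for the graph [AT :|: A'] as well.  If [u] is
    not a [D]-ancestor of [w], then [w] is reached avoiding [u]: going backwards
    from [w], take low arcs (or [D]-parents) if [w] precedes [u]; if [w] comes
    after the whole subtree of [u], take high arcs (or [D]-parents) until the
    walk reaches [s] or gets before [u]. *)
(* [Defs] comes last because its [arc] must shadow [path.arc]. *)
From mathcomp Require Import all_boot zify.
Require Import Defs.
Set Implicit Arguments.
Unset Strict Implicit.
Unset Printing Implicit Defensive.

(** * Dominance and immediate dominators *)

Section Dominance.

Variables (V : finType) (A : {set V * V}) (s : V).
Implicit Types (u v w x : V) (q : seq V).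

(** Only heads of arcs are tested, so the start of a walk is exempt; hence the separate case
    [u == s] in [dominatesP]. *)
Definition avoiding_arc u : rel V := [rel x y | arc A x y && (y != u)].

Lemma path_avoiding u x q :
  path (avoiding_arc u) x q = path (arc A) x q && (u \notin q).
Proof.
elim: q x => //= y q IHq x; rewrite IHq in_cons negb_or (eq_sym u y).
by rewrite /= -!andbA; congr (_ && _); rewrite andbCA.
Qed.

Lemma dominatesP u w :
  reflect (dominates A s u w) ((u == s) || ~~ connect (avoiding_arc u) s w).
Proof.
apply: (iffP idP) => [/orP[/eqP-> q _ _|nC q pq qw]|Duw].
- exact: mem_head.
- apply: contraR nC; rewrite in_cons negb_or => /andP[_ uq].
  by apply/connectP; exists q; rewrite ?path_avoiding ?pq.
case: eqVneq => //= us; apply/negP => /connectP[q].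
rewrite path_avoiding => /andP[pq uq] qw.
by have := Duw q pq (esym qw); rewrite in_cons (negPf us) (negPf uq).
Qed.

Lemma dominates_refl v : dominates A s v v.
Proof. by move=> q _ <-; apply: mem_last. Qed.

Lemma dominates_trans u v w :
  dominates A s u v -> dominates A s v w -> dominates A s u w.
Proof.
move=> Duv Dvw q pq qw; have vin := Dvw q pq qw.
move: pq qw; case/splitPl: vin => q1 q2 q1v; rewrite cat_path => /andP[pq1 _] _.
by have := Duv q1 pq1 q1v; rewrite -cat_cons mem_cat => ->.
Qed.

Lemma uniq_walk v : connect (arc A) s v ->
  exists q, [/\ path (arc A) s q, last s q = v & uniq (s :: q)].
Proof.
by case/connectP => q pq ->; case/shortenP: pq => q' pq' uq' _; exists q'.
Qed.

(* The walk to [u] followed by the part of [q] after [u] reaches [v], and that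
   part contains no vertex preceding [u] on [q]. *)
Lemma dominates_index q v x u :
    path (arc A) s q -> last s q = v -> uniq (s :: q) ->
    dominates A s x v -> u \in s :: q ->
    index x (s :: q) <= index u (s :: q) ->
  dominates A s x u.
Proof.
move=> pq qv uq Dxv uin le_xu r pr ru.
have [q1 [q2 [Eq q1u]]] : exists q1 q2, q = q1 ++ q2 /\ last s q1 = u.
  by case/splitPl: {-1}q / uin (erefl q) => q1 q2 q1u Eq; exists q1, q2.
move: pq qv; rewrite Eq cat_path last_cat q1u => /andP[_ pq2] q2v.
have := Dxv (r ++ q2); rewrite cat_path pr ru pq2 last_cat ru => /(_ isT q2v).
rewrite -cat_cons mem_cat => /orP[//|xq2].
move: uq le_xu; rewrite Eq -cat_cons cat_uniq => /and3P[_ /hasPn nq2 _].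
have uq1 : u \in s :: q1 by rewrite -q1u mem_last.
rewrite !index_cat uq1 (negPf (nq2 _ xq2)) => le_xu.
have := index_mem u (s :: q1); rewrite uq1.
by move=> lt_u; have := leq_ltn_trans (leq_trans (leq_addr _ _) le_xu) lt_u;
  rewrite ltnn.
Qed.

Hypothesis hG : flow_graph A s.

(** Both vertices lie on any simple walk to [w], and the earlier one dominates the later. *)
Lemma dominates_total u v w : dominates A s u w -> dominates A s v w ->
  dominates A s u v \/ dominates A s v u.
Proof.
move=> Duw Dvw; have [q [pq qw uq]] := uniq_walk (hG w).
have [le|/ltnW le] := leqP (index u (s :: q)) (index v (s :: q)); [left|right].
  by apply: (dominates_index pq qw uq) le => //; apply: Dvw.
by apply: (dominates_index pq qw uq) le => //; apply: Duw.
Qed.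

Lemma dominates_anti u v : dominates A s u v -> dominates A s v u -> u = v.
Proof.
move=> Duv Dvu; have [q [pq qv uq]] := uniq_walk (hG v).
have uin := Duv q pq qv; move: pq qv uq.
case/splitPl: uin => q1 q2 q1u; rewrite cat_path last_cat q1u.
move=> /andP[pq1 _] q2v; rewrite -cat_cons cat_uniq => /and3P[_ /hasPn nq2 _].
(* The prefix [q1] reaching [u] already contains [v], the last vertex of a simple walk, so nothing
   can follow [u]. *)
case: q2 q2v nq2 => //= y q2 q2v /(_ v); rewrite -q2v mem_last => /(_ isT).
by rewrite q2v (Dvu q1 pq1 q1u).
Qed.

(** The witness is the last proper dominator of [v] on a simple walk to [v]. *)
Lemma immediate_dominator_exists v :
  v != s -> exists u, immediate_dominator A s v u.
Proof.
move=> vs; have [q [pq qv uq]] := uniq_walk (hG v).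
pose P := [pred x | (x != v) && ((x == s) || ~~ connect (avoiding_arc x) s v)].
have Ps : P s by rewrite /= eq_sym vs eqxx.
case: (@arg_maxnP _ s P (fun x => index x (s :: q)) Ps).
move=> u /andP[/eqP uv /dominatesP Duv] max_u.
exists u; split=> // x Dxv /eqP xv.
apply: (dominates_index pq qv uq) => //; first exact: Duv.
by apply: max_u; rewrite /= xv; apply/dominatesP.
Qed.

Lemma predecessor_neq v : v != s -> exists2 x, (x, v) \in A & x != v.
Proof.
move=> vs; have [q [pq qv uq]] := uniq_walk (hG v).
case/lastP: q pq qv uq => [_ /= sv|q y]; first by rewrite sv eqxx in vs.
rewrite rcons_path last_rcons => /andP[_ xy] <-.
rewrite -rcons_cons rcons_uniq => /andP[yq _]; exists (last s q) => //.
by apply: contraNneq yq => <-; apply: mem_last.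
Qed.

Lemma unique_predecessor_dominates v x :
  v != s -> (forall y, (y, v) \in A -> y = x) -> dominates A s x v.
Proof.
move=> vs vx q; case/lastP: q => [_ /= sv|q y]; first by rewrite sv eqxx in vs.
rewrite rcons_path last_rcons => /andP[_ xy] yv; rewrite yv in xy *.
by rewrite -(vx _ xy) -rcons_cons mem_rcons in_cons mem_last orbT.
Qed.

(* Since [u != v], a walk to a predecessor [x] of [v] extends to [v] without
   gaining the vertex [u]. *)
Lemma dominates_predecessor u v x :
  dominates A s u v -> u <> v -> (x, v) \in A -> dominates A s u x.
Proof.
move=> Duv uv xv q pq qx; have := Duv (rcons q v).
rewrite rcons_path last_rcons pq qx => /(_ xv erefl).
by rewrite -rcons_cons mem_rcons in_cons => /orP[/eqP|].
Qed.

End Dominance.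

Lemma dominatesS (V : finType) (A B : {set V * V}) (s u w : V) :
  B \subset A -> dominates A s u w -> dominates B s u w.
Proof.
move=> /subsetP sBA D q pq; apply: D; apply: sub_path pq => x y; exact: sBA.
Qed.

Lemma connect_closed (V : finType) (E : {set V * V}) (P : pred V) :
    (forall x y, P x -> (x, y) \in E -> P y) ->
  forall x y, P x -> connect (arc E) x y -> P y.
Proof.
move=> PE x y Px /connectP[q pq ->].
elim: q x Px pq => //= z q IHq x Px /andP[xz pq].
exact: IHq (PE _ _ Px xz) pq.
Qed.

(* Preorder lists and the intervals of subtrees *)
Scheme preorder_mind := Minimality for preorder Sort Prop
  with preorders_mind := Minimality for preorders Sort Prop.
Combined Scheme preorder_preorders_ind from preorder_mind, preorders_mind.

Section Preorder.

Variables (V : finType) (E : {set V * V}).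

Lemma preorder_head v l : preorder E v l -> exists l', l = v :: l'.
Proof. by case=> u cs l' _ _ _; exists l'. Qed.

Lemma mem_preorder_sound :
  (forall v l, preorder E v l -> {in l, forall x, connect (arc E) v x}) /\
  (forall cs l, preorders E cs l ->
     {in l, forall x, exists2 c, c \in cs & connect (arc E) c x}).
Proof.
apply: preorder_preorders_ind => [v cs l _ Ecs _ IHl|//|c cs l ls _ IHl _ IHls].
  move=> x; rewrite in_cons => /orP[/eqP->|/IHl[c]]; first exact: connect0.
  by rewrite Ecs => vc; apply: connect_trans (connect1 _).
move=> x; rewrite mem_cat => /orP[/IHl cx|/IHls[d dcs dx]].
  by exists c => //; rewrite mem_head.
by exists d => //; rewrite in_cons dcs orbT.
Qed.

Lemma mem_preorder_closed :
  (forall v l, preorder E v l -> forall x y, x \in l -> (x, y) \in E -> y \in l)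
  /\ (forall cs l, preorders E cs l -> {subset cs <= l} /\
        forall x y, x \in l -> (x, y) \in E -> y \in l).
Proof.
apply: preorder_preorders_ind => [v cs l _ Ecs _ [cs_l IHl]|//|].
  move=> x y; rewrite !in_cons => /orP[/eqP->|xl xy].
    by rewrite -Ecs => /cs_l->; rewrite orbT.
  by rewrite (IHl x) ?orbT.
move=> c cs l ls pl IHl _ [cs_ls IHls]; split=> [x|x y].
  rewrite in_cons mem_cat => /orP[/eqP->|/cs_ls->]; last by rewrite orbT.
  by have [l' ->] := preorder_head pl; rewrite mem_head.
rewrite !mem_cat => /orP[xl|xl] xy; first by rewrite (IHl x).
by rewrite (IHls x) ?orbT.
Qed.

Lemma mem_preorder v l x : preorder E v l -> (x \in l) = connect (arc E) v x.
Proof.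
move=> pl; apply/idP/idP => [|vx]; first exact: (mem_preorder_sound.1 _ _ pl).
apply: (connect_closed (mem_preorder_closed.1 _ _ pl) _ vx).
by have [l' ->] := preorder_head pl; rewrite mem_head.
Qed.

(** The traversal of a subtree is never interrupted; this is the source of the intervals in
    [descendant_interval]. *)
Lemma preorder_block :
  (forall v l, preorder E v l -> {in l, forall x, exists a b c,
     l = a ++ b ++ c /\ preorder E x b}) /\
  (forall cs l, preorders E cs l -> {in l, forall x, exists a b c,
     l = a ++ b ++ c /\ preorder E x b}).
Proof.
apply: preorder_preorders_ind => [v cs l ucs Ecs pl IHl|//|c cs l ls _ IHl _ IHls].
  move=> x; rewrite in_cons => /orP[/eqP->|/IHl[a [b [c [-> pb]]]]].
    by exists [::], (v :: l), [::]; rewrite cats0; split=> //; exists cs.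
  by exists (v :: a), b, c.
move=> x; rewrite mem_cat => /orP[/IHl|/IHls] [a [b [d [-> pb]]]].
  by exists a, b, (d ++ ls); rewrite !catA.
by exists (l ++ a), b, d; rewrite !catA.
Qed.

(* Acyclicity and in-degree at most one, in the form needed to see that the
   blocks of distinct children are disjoint. *)
Hypothesis acyclicE : forall v c, (v, c) \in E -> ~~ connect (arc E) c v.
Hypothesis disjE : forall v c d x, (v, c) \in E -> (v, d) \in E ->
  connect (arc E) c x -> connect (arc E) d x -> c = d.

Lemma preorder_uniq v l : preorder E v l -> uniq l.
Proof.
(* For a forest, the roots must be distinct children of one vertex, so that [disjE] separates their
   blocks. *)
suff [+ _] : (forall v l, preorder E v l -> uniq l) /\
  (forall cs l, preorders E cs l ->
     uniq cs -> (exists v, forall c, c \in cs -> (v, c) \in E) -> uniq l).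
  exact.
apply: preorder_preorders_ind => [{}v cs {}l ucs Ecs pl IHl|//|].
  rewrite /= IHl ?andbT //; last by exists v => c; rewrite Ecs.
  apply/negP => /(mem_preorder_sound.2 _ _ pl)[c].
  by rewrite Ecs => /acyclicE/negPf->.
move=> c cs {}l ls pl ul pls IHls /= /andP[ccs ucs] [u Eu].
rewrite cat_uniq ul IHls ?andbT //; last first.
  by exists u => d dcs; apply: Eu; rewrite in_cons dcs orbT.
apply/hasPn => x /(mem_preorder_sound.2 _ _ pls)[d dcs dx].
apply: contraNN ccs => /=; rewrite (mem_preorder _ pl) => cx.
suff -> : c = d by [].
by apply: disjE cx dx; apply: Eu; rewrite ?mem_head // in_cons dcs orbT.
Qed.

Lemma descendant_interval r l v : preorder E r l -> v \in l ->
  exists2 e, e <= size l & forall x, x \in l ->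
    descendant E v x = (index v l <= index x l < e).
Proof.
move=> pl vl; have ul := preorder_uniq pl.
have [a [b [c [El pb]]]] := preorder_block.1 _ _ pl _ vl.
(* The block [b] of [v] starts with [v] at position [size a], so this bound is exclusive. *)
exists (size a + size b); first by rewrite El !size_cat; lia.
move=> x _; rewrite /descendant -(mem_preorder x pb).
move: ul; rewrite El cat_uniq => /and3P[_ /hasPn na _].
have [b' Eb] := preorder_head pb.
have vb : v \in b by rewrite Eb mem_head.
have va : v \notin a by apply: (na); rewrite mem_cat vb.
have v0 : index v b = 0 by rewrite Eb /= eqxx.
rewrite !index_cat vb (negPf va) v0 addn0.
have [xa|xa] := boolP (x \in a).
  have /negPf-> : x \notin b.
    by apply: contraL xa => xb; apply: (na); rewrite mem_cat xb.
  by move: xa; rewrite -index_mem; lia.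
rewrite leq_addr ltn_add2l; case: ifP => xb; first by rewrite index_mem xb.
by rewrite ltnNge leq_addr.
Qed.

End Preorder.

(** * Avoiding walks from a low-high order *)

Section LowHigh.

Variables (V : finType) (B D : {set V * V}) (s : V) (p : seq V).
Variables (d : V -> V) (e : V -> nat).
Hypothesis p_uniq : uniq p.
Hypothesis p_all : forall v, v \in p.
Hypothesis descD : forall v, descendant D s v.
Hypothesis dD : forall v, v != s -> (d v, v) \in D /\ d v != v.
Hypothesis e_size : forall v, e v <= size p.
Hypothesis descE : forall v x,
  descendant D v x = (index v p <= index x p < e v).
Hypothesis lhB : forall v, v != s -> (d v, v) \in B \/
  exists u w, low_arc B p u v /\ high_arc B D p w v.

Lemma parent_before v : v != s -> before p (d v) v.
Proof.
move=> vs; have [dv neq] := dD vs.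
have : descendant D (d v) v by apply: connect1.
rewrite descE => /andP[le_dv _]; rewrite /before ltn_neqAle le_dv andbT.
by apply: contra_neq neq; apply: (index_inj v); apply: p_all.
Qed.

Lemma parent_end v : v != s -> e v <= e (d v).
Proof.
move=> vs; have [dv _] := dD vs; rewrite leqNgt; apply/negP => lt_e.
have Dv : descendant D (d v) v by apply: connect1.
have lt_p := leq_trans lt_e (e_size v).
(* The vertex at position [e (d v)] would descend from [v] but not from [d v]. *)
pose x := nth v p (e (d v)).
have ix : index x p = e (d v) by apply: index_uniq.
have Dx : descendant D v x.
  by move: Dv; rewrite !descE ix => /andP[_ /ltnW->].
by have := connect_trans Dv Dx; rewrite -/(descendant _ _ _) descE ix ltnn andbF.
Qed.

(** Each backward step, along a low arc or to the parent, lowers the index, so the walk stays before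
    [u] until it reaches [s]. *)
Lemma low_walk u w : u != s ->
  index w p < index u p -> connect (avoiding_arc B u) s w.
Proof.
move=> us; have [n] := ubnP (index w p); elim: n w => // n IHn w.
rewrite ltnS => le_n lt_u; have [->|ws] := eqVneq w s; first exact: connect0.
have wu : w != u by apply: contraTneq lt_u => ->; rewrite ltnn.
have step x : (x, w) \in B -> before p x w -> connect (avoiding_arc B u) s w.
  rewrite /before => xw lt_x; apply: (connect_trans (IHn x _ _)); try lia.
  by apply: connect1; apply/andP.
case: (lhB ws) => [dw|[x [_ [[xw lt_x] _]]]]; last exact: step lt_x.
exact: step dw (parent_before ws).
Qed.

(* Along the walk, the right endpoint [e] of the interval of [D]-descendants
   grows at a high arc, and at a [D]-parent it does not shrink while the
   preorder number drops. *)
Lemma avoiding_walk u w : ~~ descendant D u w -> connect (avoiding_arc B u) s w.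
Proof.
move=> nDuw; have us : u != s by apply: contraNneq nDuw => ->.
(* Lexicographic measure: [size p - e w] first, then [index w p], which is below [(size p).+1]. *)
have [n] := ubnP ((size p - e w) * (size p).+1 + index w p).
elim: n w nDuw => // n IHn w nDuw; rewrite ltnS => le_n.
have [->|ws] := eqVneq w s; first exact: connect0.
have wu : w != u by apply: contraNneq nDuw => ->; apply: connect0.
have [lt_u|le_u] := ltnP (index w p) (index u p); first exact: low_walk.
have step x : (x, w) \in B -> connect (avoiding_arc B u) s x ->
    connect (avoiding_arc B u) s w.
  by move=> xw cx; apply: connect_trans cx (connect1 _); apply/andP.
have lt_size x : index x p < size p by rewrite index_mem.
have := descE w w; rewrite /descendant connect0 leqnn => /esym /= lt_w.
case: (lhB ws) => [dw|[_ [x [_ [xw lt_x nDwx]]]]].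
  apply: (step (d w)) => //; apply: IHn.
    apply: contraNN nDuw => Dud; apply: connect_trans Dud (connect1 _).
    by case: (dD ws).
  have := parent_before ws; have := parent_end ws; rewrite /before.
  have := e_size (d w); nia.
apply: (step x) => //.
have := descE x x; rewrite /descendant connect0 leqnn => /esym /= lt_ex.
move: nDuw nDwx lt_x; rewrite !descE /before => nDuw nDwx lt_x.
(* Following [w] without descending from it, [x] lies at or beyond [e w], and [e x] exceeds the
   position of [x]. *)
have lt_e : e w < e x by lia.
apply: IHn; first by rewrite descE; lia.
have := e_size x; have := lt_size x; nia.
Qed.

End LowHigh.

(** * Tree structure of immediate dominance *)

Section DominatorTree.

Variables (V : finType) (A D : {set V * V}) (s : V).
Hypothesis hG : flow_graph A s.
Hypothesis hD : dominator_tree A s D.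

Lemma dominator_treeP u v :
  (u, v) \in D -> v != s /\ immediate_dominator A s v u.
Proof. by move=> /hD. Qed.

Lemma parent_in_dominator_tree v : v != s -> (parent D v, v) \in D.
Proof.
move=> vs; have [u Iu] := immediate_dominator_exists hG vs.
by rewrite /parent; case: pickP => //= /(_ u); rewrite (introT idP ((hD u v).2 _)).
Qed.

Lemma descendant_dominates u w : descendant D u w -> dominates A s u w.
Proof.
case/connectP => q pq ->; elim: q u pq => [|x q IHq] u /=.
  by move=> _; apply: dominates_refl.
case/andP => /dominator_treeP[_ [Dux _ _]] /IHq.
exact: dominates_trans.
Qed.

(** The immediate dominator of [v] lies on a given walk to [v], strictly before its end, so
    induction on the length climbs to [s]. *)
Lemma root_descendant v : descendant D s v.
Proof.
have /connectP[q pq ->] := hG v.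
have [n] := ubnP (size q); elim: n q pq => // n IHn q pq; rewrite ltnS => le_n.
have [->|vs] := eqVneq (last s q) s; first exact: connect0.
have uv := parent_in_dominator_tree vs; have [_ [Duv neq _]] := dominator_treeP uv.
apply: (@connect_trans _ _ (parent D (last s q))) (connect1 uv).
have := Duv q pq erefl; move: neq; move: (parent D _) => u neq uin.
move: pq le_n neq; case/splitPl: uin => q1 q2 q1u.
rewrite cat_path size_cat last_cat q1u => /andP[pq1 _] le_n.
case: q2 le_n => //= y q2 le_n _; rewrite -q1u.
by apply: IHn => //; rewrite (leq_trans _ le_n) // addnS ltnS leq_addr.
Qed.

Lemma dominator_tree_acyclic v c : (v, c) \in D -> ~~ connect (arc D) c v.
Proof.
case/dominator_treeP => _ [Dvc neq _]; apply/negP => /descendant_dominates Dcv.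
exact: neq (dominates_anti hG Dvc Dcv).
Qed.

(** Both children dominate [x], so one dominates the other; if distinct, the dominating one would
    also dominate [v], against antisymmetry. *)
Lemma siblings_disjoint v c c' x : (v, c) \in D -> (v, c') \in D ->
  connect (arc D) c x -> connect (arc D) c' x -> c = c'.
Proof.
have dom_eq b b' : (v, b) \in D -> (v, b') \in D -> dominates A s b b' -> b = b'.
  move=> /dominator_treeP[_ [Dvb neq _]] /dominator_treeP[_ [_ _ Iv]] Dbb'.
  apply/eqP/negPn/negP => /eqP bb'.
  exact: neq (dominates_anti hG Dvb (Iv _ Dbb' bb')).
move=> vc vc' /descendant_dominates Dc /descendant_dominates Dc'.
by have [/dom_eq->|/dom_eq->] := dominates_total hG Dc Dc'.
Qed.

Lemma dominator_preorder_intervals p : preorder D s p ->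
  exists e : V -> nat, forall v, e v <= size p /\
    forall x, descendant D v x = (index v p <= index x p < e v).
Proof.
move=> pp; have p_all v : v \in p by rewrite (mem_preorder v pp); apply: root_descendant.
have h v : exists e, e <= size p /\
    forall x, descendant D v x = (index v p <= index x p < e).
  have [e le_e eE] := descendant_interval dominator_tree_acyclic
    siblings_disjoint pp (p_all v).
  by exists e; split=> // x; apply: eE.
exact: (fin_all_exists h).
Qed.

End DominatorTree.

(** * Parents in the spanning tree *)

Section TreeParent.

Variables (V : finType) (AT : {set V * V}) (s : V).
Hypothesis hT : spanning_tree AT s.

Lemma spanning_tree_parent v : v != s -> (parent AT v, v) \in AT.
Proof.
case: hT => _ uT _ /uT[u [uv _]].
by rewrite /parent; case: pickP => //= /(_ u); rewrite uv.
Qed.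

Lemma spanning_tree_parentE u v : v != s -> (u, v) \in AT -> u = parent AT v.
Proof.
move=> vs uv; have pv := spanning_tree_parent vs.
by case: hT => _ uT _; have [x [_ xu]] := uT v vs; rewrite -(xu _ uv) (xu _ pv).
Qed.

Lemma spanning_tree_parent_neq v : v != s -> parent AT v != v.
Proof.
move=> vs; case: (hT) => _ _ cT; have [x xv] := predecessor_neq cT vs.
by rewrite (spanning_tree_parentE vs xv).
Qed.

(** The parent, as the only tree predecessor of [v], dominates [v] in the tree; antisymmetry
    excludes the converse. *)
Lemma not_dominates_parent v : v != s -> ~ dominates AT s v (parent AT v).
Proof.
move=> vs Dvt; case: (hT) => _ _ cT; case/eqP: (spanning_tree_parent_neq vs).
apply: (dominates_anti cT) => //.
by apply: unique_predecessor_dominates => // y; apply: spanning_tree_parentE.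
Qed.

End TreeParent.

Theorem theorem1 (V : finType) (A : {set V * V}) (s : V)
    (AT D : {set V * V}) (p : seq V)
    (hG : flow_graph A s)
    (hTA : AT \subset A) (hT : spanning_tree AT s)
    (hD : dominator_tree A s D)
    (hp : low_high_order A s D p) :
  [/\ (forall v : V, v != s -> (parent D v, v) \notin A ->
         before p v (parent AT v) -> exists x : V, low_arc A p x v),
      (forall v : V, v != s -> (parent D v, v) \notin A ->
         before p (parent AT v) v -> exists x : V, high_arc A D p x v),
      (forall v : V, v != s -> exists S : {set V * V}, step A AT D p v S)
    & (forall A' : {set V * V}, construction A s AT D p A' ->
         minimum_valid A s AT A')].

Proof.
case: hp => pp lh.
have [e eP] := dominator_preorder_intervals hG hD pp.
have p_all v : v \in p by rewrite (mem_preorder v pp); apply: (root_descendant hG hD v).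
have p_uniq : uniq p.
  apply: preorder_uniq pp; first exact: (dominator_tree_acyclic hG hD).
  exact: (siblings_disjoint hG hD).
have idom v : v != s -> immediate_dominator A s v (parent D v).
  by move=> vs; have /(dominator_treeP hD)[] := parent_in_dominator_tree hG hD vs.
have tA v : v != s -> (parent AT v, v) \in A.
  by move=> vs; apply: (subsetP hTA); apply: (spanning_tree_parent hT vs).
(* Dominance in [A] persists in the subgraph [AT], where [v] cannot dominate its own parent. *)
have not_desc v : v != s -> ~~ descendant D v (parent AT v).
  move=> vs; apply/negP => /(descendant_dominates hD) /(dominatesS hTA).
  exact: (not_dominates_parent hT vs).
have low_high v : v != s -> (parent D v, v) \notin A ->
    exists u w, low_arc A p u v /\ high_arc A D p w v.
  by move=> vs /negP ndv; case: (lh v vs).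
have low v : v != s -> (parent D v, v) \notin A -> exists x, low_arc A p x v.
  by move=> vs /(low_high v vs)[x [_ [? _]]]; exists x.
have high v : v != s -> (parent D v, v) \notin A -> exists x, high_arc A D p x v.
  by move=> vs /(low_high v vs)[_ [x [_ ?]]]; exists x.
split=> [v vs nA _|v vs nA _|v vs|_ [S [stepS ->]]].
- exact: low.
- exact: high.
- have [td|/eqP td] := eqVneq (parent AT v) (parent D v).
    by exists set0; apply: Step1.
  have [dA|dA] := boolP ((parent D v, v) \in A).
    by exists [set (parent D v, v)]; apply: Step2.
  case: (ltngtP (index (parent AT v) p) (index v p)) => [lt_t|lt_t|eq_t].
  + by have [x hx] := high v vs dA; exists [set (x, v)]; apply: Step3b.
  + by have [x lx] := low v vs dA; exists [set (x, v)]; apply: Step3a.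
  case/eqP: (spanning_tree_parent_neq hT vs).
  exact: (index_inj v (p_all _) (p_all _) eq_t).
set A' := \bigcup_(v | v != s) S v.
have in_A' v x : v != s -> (x, v) \in S v -> (x, v) \in AT :|: A'.
  by move=> vs xv; rewrite inE; apply/orP; right; apply/bigcupP; exists v.
have sA' : A' \subset A.
  apply/bigcupsP => v vs; case: (stepS v vs) => [_|_ dA|x _ _ []|x _ _ []] *;
    by rewrite ?sub0set ?sub1set.
have sB : AT :|: A' \subset A by rewrite subUset hTA.
have in_T v : v != s -> (parent AT v, v) \in AT :|: A'.
  by move=> vs; rewrite inE (spanning_tree_parent hT vs).
(* In cases (3a) and (3b) the tree arc and the added arc enter [v] from opposite sides; [not_desc]
   makes the tree arc a high arc in (3a). *)
have lhB v : v != s -> (parent D v, v) \in AT :|: A' \/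
    exists u w, low_arc (AT :|: A') p u v /\ high_arc (AT :|: A') D p w v.
  move=> vs; have := in_A' v; have tB := in_T v vs.
  case: (stepS v vs) => [<-|_ _|x _ lt_t [_ lt_x]|x _ lt_t [_ lt_x nD]] inA'.
  - by left.
  - by left; apply: inA'; rewrite ?set11.
  - right; exists x, (parent AT v); split; split=> //; last exact: not_desc.
    by apply: inA'; rewrite ?set11.
  - right; exists (parent AT v), x; split; split=> //.
    by apply: inA'; rewrite ?set11.
split=> [|A'' [sA'' domA'']].
  split=> // u w; split=> [Duw|]; last exact: dominatesS.
  have [/(descendant_dominates hD)//|nD] := boolP (descendant D u w).
  have us : u != s by apply: contraNneq nD => ->; apply: (root_descendant hG hD w).
  have dD v : v != s -> (parent D v, v) \in D /\ parent D v != v.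
    move=> vs; split; first exact: (parent_in_dominator_tree hG hD vs).
    by have [_ /eqP] := idom v vs.
  have /dominatesP := Duw; rewrite (negPf us) /=.
  suff -> : connect (avoiding_arc (AT :|: A') u) s w by [].
  apply: (avoiding_walk (p := p) (d := parent D) (e := e)) nD => // v.
  - exact: (root_descendant hG hD).
  - by have [] := eP v.
  - by have [_] := eP v.
pose W := [set v | (v != s) && (parent AT v != parent D v)].
have le_A' : #|A'| <= #|W|.
  have le_sum : #|A'| <= \sum_(v | v != s) #|S v|.
    rewrite /A'; elim/big_rec2: _ => [|v n T _ le_n]; first by rewrite cards0.
    by rewrite (leq_trans (leq_card_setU _ _)) // leq_add2l.
  apply: (leq_trans le_sum); rewrite -sum1_card.
  rewrite (eq_bigl _ _ (fun v => in_set _ v)) big_mkcondr /=.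
  apply: leq_sum => v vs.
  have [td|ntd] := eqVneq (parent AT v) (parent D v); last first.
    by case: (stepS v vs) => *; rewrite ?cards0 ?cards1.
  (* With equal parents the tree arc puts [(parent D v, v)] in [A], so only [Step1] remains. *)
  by case: (stepS v vs) => [_|/(_ td)|x /negP[]|x /negP[]] //;
    rewrite ?cards0 // -td tA.
apply: (leq_trans le_A').
suff /subset_leq_card le_W : W \subset [set a.2 | a in A''].
  exact: leq_trans le_W (leq_imset_card _ _).
apply/subsetP => v; rewrite inE => /andP[vs ntd].
have [/existsP[x xv]|/existsPn nx] := boolP [exists x, (x, v) \in A''].
  by apply/imsetP; exists (x, v).
have [Ddv ndv Iv] := idom v vs.
(* With no arc of [A''] into [v], the tree parent is its only predecessor in the valid subgraph;
   validity carries the dominance back to [A]. *)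
have Dtv : dominates A s (parent AT v) v.
  apply/domA''; apply: unique_predecessor_dominates => // y.
  by rewrite inE (negPf (nx y)) orbF; apply: (spanning_tree_parentE hT vs).
(* The tree parent, a proper dominator of [v], dominates [parent D v], which in turn dominates every
   predecessor of [v]. *)
case/eqP: ntd; apply: (dominates_anti hG).
  by apply: Iv => //; apply/eqP; apply: (spanning_tree_parent_neq hT vs).
exact: dominates_predecessor Ddv ndv (tA v vs).
Qed.
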